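(* For every integer $n\ge 4$ there exist a connected directed graph $G=(V,E)$ on $|V|=n$ nodes and a vector $c\in\mathbb{R}^{|E|}$ such that the circuit diameter of the dual network flow polyhedron $P_{G,c}$ satisfies $$\operatorname{diam}_{\mathcal{C}}(P_{G,c})\;\ge\;\frac{4}{3}|V|-4.$$
   Context: Directed graphs are finite, without loops and without parallel arcs: $E$ is a set of ordered pairs $ab$ of distinct nodes $a,b\in V$ (arc from tail $a$ to head $b$); both $ab$ and $ba$ may be present. ''Connected'' means that the underlying undirected graph is connected. One node of $V$ is designated as node $0$. For $c\in\mathbb{R}^{|E|}$, the dual network flow polyhedron is $$P_{G,c}=\{u\in\mathbb{R}^{|V|}: -u_a+u_b\le c_{ab}\ \text{ for all } ab\in E,\ u_0=0\}.$$ Circuits. For a polyhedron $P=\{z\in\mathbb{R}^n: A^1z=b^1,\ A^2z\ge b^2\}$ with rational matrices $A^1,A^2$, the set of circuits $\mathcal{C}(A^1,A^2)$ consists of those vectors $g\in\ker(A^1)\setminus\{0\}$, normalized to coprime integer components, for which $A^2g$ is support-minimal in the set $\{A^2x: x\in\ker(A^1)\setminus\{0\}\}$. For $P_{G,c}$ the matrices are those of its defining description above: $A^1u=b^1$ is the equation $u_0=0$ and $A^2u\ge b^2$ is the system $u_a-u_b\ge -c_{ab}$, $ab\in E$. Note that if $g$ is a circuit, so is $-g$. Circuit walks. For vertices $v^{(1)},v^{(2)}$ of $P$, a circuit walk of length $k$ from $v^{(1)}$ to $v^{(2)}$ is a sequence $v^{(1)}=y^{(0)},\dots,y^{(k)}=v^{(2)}$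 such that for all $i=0,\dots,k-1$: (1) $y^{(i)}\in P$; (2) $y^{(i+1)}-y^{(i)}=\alpha_i g^{(i)}$ for some $g^{(i)}\in\mathcal{C}(A^1,A^2)$ and $\alpha_i>0$; (3) $y^{(i)}+\alpha g^{(i)}\notin P$ for all $\alpha>\alpha_i$. The circuit distance from $v^{(1)}$ to $v^{(2)}$ is the minimum length of a circuit walk from $v^{(1)}$ to $v^{(2)}$, and the circuit diameter $\operatorname{diam}_{\mathcal{C}}(P)$ is the maximum circuit distance between any two vertices of $P$ (for a polyhedron $P$ that has at least one vertex). *)

(* Defs.v *)
From mathcomp Require Import all_boot all_order all_algebra.
From mathcomp Require Import reals.

Set Implicit Arguments.
Unset Strict Implicit.
Unset Printing Implicit Defensive.

Import Order.TTheory GRing.Theory Num.Theory.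
Local Open Scope ring_scope.

(* A description {z | A1 z = b1, A2 z >= b2} is kept as data, because circuits
   depend on the matrices and not only on the point set. The theory of circuits
   takes rational matrices; those of dual_network_flow have entries 0, 1, -1. *)
Record polyhedron (R : realType) (n : nat) := Polyhedron {
  neq : nat;
  nineq : nat;
  eq_mx : 'M[R]_(neq, n);
  eq_rhs : 'cV[R]_neq;
  ineq_mx : 'M[R]_(nineq, n);
  ineq_rhs : 'cV[R]_nineq }.

Section Circuits.
Variables (R : realType) (n : nat) (P : polyhedron R n).
Implicit Types (x y z v w g : 'cV[R]_n) (k d : nat).

Definition in_poly z : Prop :=
  eq_mx P *m z = eq_rhs P /\
  forall i, ineq_rhs P i 0 <= (ineq_mx P *m z) i 0.

(* Extreme points. *)
Definition vertex v : Prop :=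
  in_poly v /\
  forall x y (t : R), in_poly x -> in_poly y -> 0 < t < 1 ->
    v = t *: x + (1 - t) *: y -> x = v /\ y = v.

Definition supp m (z : 'cV[R]_m) : {set 'I_m} := [set i | z i 0 != 0].

Definition coprime_integral g : Prop :=
  exists z : 'cV[int]_n,
    g = map_mx intr z /\ \big[gcdn/0%N]_(i < n) absz (z i 0) = 1%N.

Definition nonzero_ker x : Prop := x != 0 /\ eq_mx P *m x = 0.

Definition circuit g : Prop :=
  [/\ nonzero_ker g, coprime_integral g &
      forall x, nonzero_ker x ->
        ~~ (supp (ineq_mx P *m x) \proper supp (ineq_mx P *m g))].

Definition circuit_step y y' : Prop :=
  exists g (alpha : R),
    [/\ circuit g, 0 < alpha, y' - y = alpha *: g &
        forall beta : R, alpha < beta -> ~ in_poly (y + beta *: g)].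

(* Only the values p 0, ..., p k are relevant. *)
Definition circuit_walk v w k (p : nat -> 'cV[R]_n) : Prop :=
  [/\ p 0%N = v, p k = w &
      forall i, (i < k)%N -> in_poly (p i) /\ circuit_step (p i) (p i.+1)].

Definition circuit_distance v w k : Prop :=
  (exists p, circuit_walk v w k p) /\
  forall l p, circuit_walk v w l p -> (k <= l)%N.

(* A maximum over the attained distances: pairs without a walk, if there were
   any, would not contribute. *)
Definition circuit_diameter d : Prop :=
  (exists v w, [/\ vertex v, vertex w & circuit_distance v w d]) /\
  forall v w k, vertex v -> vertex w -> circuit_distance v w k -> (k <= d)%N.

End Circuits.

Record digraph (n : nat) := Digraph {
  arcs : {set 'I_n * 'I_n};
  loopless : forall a, (a, a) \notin arcs }.

Definition connected n (G : digraph n) : Prop :=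
  forall a b,
    connect (fun x y => ((x, y) \in arcs G) || ((y, x) \in arcs G)) a b.

(* The i-th inequality belongs to the i-th arc ab = enum_val i and reads
   u_a - u_b >= - c_ab; the node o plays the role of node 0. *)
Definition dual_network_flow (R : realType) n (G : digraph n) (o : 'I_n)
    (c : 'cV[R]_#|arcs G|) : polyhedron R n :=
  {| eq_mx := delta_mx 0 o : 'rV[R]_n;
     eq_rhs := 0;
     ineq_mx := \matrix_(i < #|arcs G|, j < n)
       ((j == (enum_val i).1)%:R - (j == (enum_val i).2)%:R);
     ineq_rhs := - c |}.

Lemma in_dual_network_flow (R : realType) n (G : digraph n) (o : 'I_n)
    (c : 'cV[R]_#|arcs G|) (u : 'cV[R]_n) :
  in_poly (dual_network_flow o c) u <->
  (forall i : 'I_#|arcs G|,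
     - u (enum_val i).1 0 + u (enum_val i).2 0 <= c i 0) /\ u o 0 = 0.
Proof.
have E1 : (delta_mx 0 o : 'rV[R]_n) *m u = (u o 0)%:M.
  by rewrite -rowE [LHS]mx11_scalar mxE.
have S (a : 'I_n) : \sum_j (j == a)%:R * u j 0 = u a 0.
  rewrite (bigD1 a) //= eqxx mul1r big1 ?addr0 // => j /negPf ->.
  by rewrite mul0r.
have E2 i : (ineq_mx (dual_network_flow o c) *m u) i 0
            = u (enum_val i).1 0 - u (enum_val i).2 0.
  rewrite mxE -[in RHS]S -[in RHS](S (enum_val i).2) -sumrB.
  by apply: eq_bigr => j _; rewrite mxE mulrBl.
rewrite /in_poly /= E1; split=> -[H1 H2].
  split=> [i|].
    by move: (H2 i); rewrite E2 !mxE lerNl opprB addrC.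
  by move/matrixP/(_ 0 0): H1; rewrite !mxE eqxx mulr1n.
split=> [|i]; first by rewrite H2; apply/matrixP => i j; rewrite !mxE mul0rn.
by rewrite E2 !mxE lerNl opprB addrC; apply: H1.
Qed.

(* Main.v *)
Require Import Defs.
From mathcomp Require Import all_boot all_order all_algebra.
From mathcomp Require Import reals.
From mathcomp Require Import boolp zify lra.

Import Order.TTheory GRing.Theory Num.Theory.
Local Open Scope ring_scope.

(* If the blocks of a graph all meet in node 0, its polyhedron is the product of
   the polyhedra of the blocks; every circuit is supported in one block, so
   circuit distances add up over the blocks. It thus suffices to exhibit one
   block with 3 nodes besides 0 and two vertices at circuit distance 4. The
   gadget below was found by computer search. Any two of its nodes are adjacent,
   so its circuits are the vectors +1_S and -1_S for the nonempty sets S of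
   nodes other than 0. A step from an integral point is therefore determined by
   the sign and S, and ends at an integral point: only 37 points are reachable
   in 3 steps, and the target is not among them.
   If 3 does not divide n - 1, the last block is a truncated gadget, where the
   walk stays at one vertex. The maximum defining the diameter exists because a
   vertex is determined by its tight inequalities. *)

(** * The gadget: integer states, moves and reachability *)

Definition garcs : seq (nat * nat) :=
  [:: (0, 1); (0, 2); (0, 3); (1, 0); (1, 2); (1, 3); (2, 0); (3, 0); (3, 2)]%N.

Definition gcost (t t' : nat) : int :=
  match t, t' with
  | 0, 1 => 3 | 0, 2 => 2 | 0, 3 => 0 | 1, 0 => 1 | 1, 2 => 2 | 1, 3 => 0
  | 2, 0 => 3 | 3, 0 => 3 | 3, 2 => 3 | _, _ => 0
  end%N.

(* A point of the gadget's polyhedron is the list of its 4 coordinates. *)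
Definition gfeas (s : seq int) : bool :=
  [&& size s == 4%N, s`_0 == 0 &
      all (fun e => s`_e.2 - s`_e.1 <= gcost e.1 e.2) garcs].

Definition gtight (s : seq int) (t t' : nat) : bool :=
  ((t, t') \in garcs) && (s`_t' - s`_t == gcost t t').

(* Each node is joined by a tight arc to a node of smaller index; hence this
   also certifies vertices of a truncated gadget. *)
Definition gtree (s : seq int) : bool :=
  all (fun t => has (fun t' => gtight s t t' || gtight s t' t) (iota 0 t))
    (iota 1 3).

Definition cube : seq (seq int) :=
  iter 3 (fun B => [seq x :: b | x <- [:: 0; 1], b <- B]) [:: [::]].

(** The circuits of the gadget and the zero vector; the latter yields no successor, because [gsucc]
    asks for an arc along which the direction grows by 1. *)
Definition gdirs : seq (seq int) :=
  [seq 0 :: [seq e * x | x <- b] | e <- [:: 1; -1], b <- cube].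

Definition gmove (s d : seq int) (alpha : int) : seq int :=
  mkseq (fun t => s`_t + alpha * d`_t) 4.

(* Moving along d by the slack of e makes e tight; if the result is feasible,
   e was the blocking arc. Slack 0 is allowed, so s may succeed itself. *)
Definition gsucc (s : seq int) : seq (seq int) :=
  [seq s' <- [seq gmove s d (gcost e.1 e.2 - (s`_e.2 - s`_e.1)) |
               d <- gdirs, e <- [seq e <- garcs | d`_e.2 - d`_e.1 == 1]] |
   gfeas s'].

Definition gstart : seq int := [:: 0; 3; -3; 0].
Definition gend : seq int := [:: 0; -1; 1; -2].

(** The moves are -3 on node 3, -4 on node 1, +3 on node 2 and +1 on nodes 2 and 3. Some walk has to
    be exhibited for the distance to be defined. *)
Definition gpath : seq (seq int) :=
  [:: gstart; [:: 0; 3; -3; -3]; [:: 0; -1; -3; -3]; [:: 0; -1; 0; -3]; gend].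

Definition greach (k : nat) : seq (seq int) :=
  iter k (fun L => undup (flatten [seq gsucc s | s <- L])) [:: gstart].

Definition same_on_gadget (s s' : seq int) : bool :=
  all (fun t => s`_t == s'`_t) (iota 0 4).

Lemma greach_far (k : nat) :
  has (fun s => same_on_gadget s gend) (greach k) -> (4 <= k)%N.
Proof.
have E : all (fun k => ~~ has (fun s => same_on_gadget s gend) (greach k))
             (iota 0 4) by vm_compute.
move=> Hk; rewrite leqNgt; apply/negP => lt_k4.
have k_in : k \in iota 0 4 by rewrite mem_iota.
by move: (allP E k k_in); rewrite Hk.
Qed.

Lemma gpath_feas : all (fun s => gfeas s) gpath.
Proof. by vm_compute. Qed.

Lemma gpath_step (i : nat) : (i < 4)%N ->
  nth gend gpath i.+1 \in gsucc (nth gend gpath i) /\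
  nth gend gpath i.+1 != nth gend gpath i.
Proof. by case: i => [|[|[|[|i]]]] // _; split; vm_compute. Qed.

Lemma garcs_total (t t' : nat) : (t < 4)%N -> (t' < 4)%N -> t != t' ->
  ((t, t') \in garcs) || ((t', t) \in garcs).
Proof. by case: t => [|[|[|[|t]]]] //; case: t' => [|[|[|[|t']]]]. Qed.

Lemma garcs_neq (t t' : nat) : (t, t') \in garcs -> t != t'.
Proof.
by move=> H; apply: (allP (_ : all (fun e => e.1 != e.2) garcs) (t, t')).
Qed.

Lemma garcs_lt4 (t t' : nat) : (t, t') \in garcs -> (t < 4)%N && (t' < 4)%N.
Proof.
by move=> H; apply: (allP (_ : all (fun e => (e.1 < 4) && (e.2 < 4))%N garcs)
  (t, t')).
Qed.

(** * Vertices, circuit distances and existence of the diameter *)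

Section General.
Variable R : realType.

(** The finitely many ratios [s i / h i] with [h i > 0] are positive, and the other indices impose
    no bound. For slacks [s] and growth [h] along a direction, this gives room to move. *)
Lemma uniform_room (I : finType) (s h : I -> R) :
  (forall i, 0 <= s i) -> (forall i, s i = 0 -> h i <= 0) ->
  exists2 e : R, 0 < e & forall i, e * h i <= s i.
Proof.
move=> s_ge0 hs.
have Hi (i : I) : exists e : R,
    0 < e /\ forall d, 0 < d -> d <= e -> d * h i <= s i.
  case: (ltP 0 (h i)) => [h_gt0|h_le0]; last first.
    exists 1; split=> // d d0 _.
    apply: le_trans (s_ge0 i).
    by apply: mulr_ge0_le0 => //; apply: ltW.
  have s_gt0 : 0 < s i.
    rewrite lt0r s_ge0 andbT; apply/eqP => /hs; lra.
  exists (s i / h i); split; first exact: divr_gt0.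
  by move=> d d0; rewrite ler_pdivlMr.
have [e He] := fin_all_exists Hi.
exists (\big[Num.min/1]_i e i).
  by apply: lt_bigmin => // i _; case: (He i).
move=> i; case: (He i) => e0; apply.
  by apply: lt_bigmin => // k _; case: (He k).
exact: bigmin_le_cond.
Qed.

Variable n : nat.
Implicit Types (P : polyhedron R n) (u v w : 'cV[R]_n).

Definition tight_rows P v : {set 'I_(nineq P)} :=
  [set i | (ineq_mx P *m v) i 0 == ineq_rhs P i 0].

(** If the tight rows agree, [v - w] is annihilated by the equations and by the rows tight at [v],
    so [v] can be moved both ways along it; extremality makes it 0. *)
Lemma vertex_tight_rows_inj P v w :
  vertex P v -> vertex P w -> tight_rows P v = tight_rows P w -> v = w.
Proof.
move=> [[v_eq v_in] v_ext] [[w_eq w_in] _] Hvw.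
pose g := v - w.
have g_eq : Defs.eq_mx P *m g = 0 by rewrite mulmxBr v_eq w_eq subrr.
have [i|i|e e0 He] := @uniform_room _
    (fun i => (ineq_mx P *m v) i 0 - ineq_rhs P i 0)
    (fun i => `|(ineq_mx P *m g) i 0|).
- by rewrite subr_ge0.
- move/eqP; rewrite subr_eq0 => Hv.
  have : i \in tight_rows P v by rewrite inE.
  rewrite Hvw inE => /eqP Hw.
  by rewrite /g mulmxBr mxE [X in _ + X]mxE (eqP Hv) Hw subrr normr0.
have in_move (d : R) : `|d| = e -> in_poly P (v + d *: g).
  move=> d_e; split=> [|i]; first by rewrite mulmxDr -scalemxAr g_eq scaler0 addr0.
  rewrite mulmxDr -scalemxAr mxE [X in _ + X]mxE.
  have := He i; rewrite -d_e -normrM => Hi.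
  have := ler_norm (- (d * (ineq_mx P *m g) i 0)); rewrite normrN; lra.
have Hp : in_poly P (v + e *: g) by apply: in_move; rewrite gtr0_norm.
have Hm : in_poly P (v + (- e) *: g) by apply: in_move; rewrite normrN gtr0_norm.
have half : 0 < (2^-1 : R) < 1 by lra.
have [|] := v_ext _ _ _ Hp Hm half.
  by apply/matrixP => i j; rewrite !mxE; lra.
move/eqP; rewrite -subr_eq0 addrC addKr scaler_eq0 gt_eqF //= subr_eq0.
by move/eqP.
Qed.

Lemma circuit_distance_exists P v w k p : circuit_walk P v w k p ->
  exists d, circuit_distance P v w d.
Proof.
move=> Hp.
have ex : exists k, `[< exists p, circuit_walk P v w k p >].
  by exists k; apply/asboolP; exists p.
case: (ex_minnP ex) => d /asboolP Hd dmin.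
by exists d; split=> // l q Hq; apply: dmin; apply/asboolP; exists q.
Qed.

Lemma circuit_distance_inj P v w k l :
  circuit_distance P v w k -> circuit_distance P v w l -> k = l.
Proof.
move=> [[p Hp] kmin] [[q Hq] lmin]; apply/eqP.
by rewrite eqn_leq (kmin _ _ Hq) (lmin _ _ Hp).
Qed.

(** By [vertex_tight_rows_inj] a distance depends only on two sets of tight rows, and there are
    finitely many pairs of such sets. *)
Lemma circuit_distance_bounded P : exists b, forall v w k,
  vertex P v -> vertex P w -> circuit_distance P v w k -> (k <= b)%N.
Proof.
have H (ST : {set 'I_(nineq P)} * {set 'I_(nineq P)}) : exists b, forall v w k,
    vertex P v -> vertex P w -> tight_rows P v = ST.1 -> tight_rows P w = ST.2 ->
    circuit_distance P v w k -> k = b.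
  have [[v [w [k [Hv Hw Sv Tw Hk]]]]|no] := pselect (exists v w k,
    [/\ vertex P v, vertex P w, tight_rows P v = ST.1, tight_rows P w = ST.2
      & circuit_distance P v w k]).
    exists k => v' w' k' Hv' Hw' Sv' Tw' Hk'.
    have Ev : v' = v by apply: (@vertex_tight_rows_inj P) => //; rewrite Sv'.
    have Ew : w' = w by apply: (@vertex_tight_rows_inj P) => //; rewrite Tw'.
    by subst v' w'; apply: circuit_distance_inj Hk' Hk.
  by exists 0%N => v w k Hv Hw Sv Tw Hk; case: no; exists v, w, k.
have [b Hb] := fin_all_exists H.
exists (\max_ST b ST)%N => v w k Hv Hw Hk.
rewrite (Hb (tight_rows P v, tight_rows P w) v w k) //.
exact: (@leq_bigmax _ b).
Qed.

(** The attained distances are bounded, and the given walk makes them nonempty, so they have a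
    maximum. *)
Lemma circuit_diameter_ge P v w k p m : vertex P v -> vertex P w ->
  circuit_walk P v w k p -> (forall l q, circuit_walk P v w l q -> (m <= l)%N) ->
  exists2 d, circuit_diameter P d & (m <= d)%N.
Proof.
move=> Hv Hw Hp Hm.
have [d0 Hd0] := circuit_distance_exists _ _ _ _ _ Hp.
pose attained d := `[< exists v w, [/\ vertex P v, vertex P w
                                     & circuit_distance P v w d] >].
have ex : exists d, attained d by exists d0; apply/asboolP; exists v, w.
have [b Hb] := circuit_distance_bounded P.
have bnd d : attained d -> (d <= b)%N.
  by move/asboolP=> [v' [w' [Hv' Hw' Hd']]]; apply: Hb Hd'.
case: (ex_maxnP ex bnd) => d /asboolP Hd dmax; exists d.
  by split=> // v' w' k' Hv' Hw' Hk'; apply: dmax; apply/asboolP; exists v', w'.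
have [[q Hq] _] := Hd0.
apply: leq_trans (Hm _ _ Hq) _.
by apply: dmax; apply/asboolP; exists v, w.
Qed.

End General.

(* Node 3 B + t with t in {1, 2, 3} is the node t of block B; node 0 is the node 0
   of every block, although blk 0 = 0. *)
Definition blk (a : nat) : nat := (a.-1 %/ 3)%N.
Definition typ (a : nat) : nat := if a is a'.+1 then (a' %% 3).+1 else 0%N.

Lemma typ_lt4 (a : nat) : (typ a < 4)%N.
Proof. by case: a => //= a; rewrite ltnS ltn_mod. Qed.

Lemma typ_eq0 (a : nat) : (typ a == 0%N) = (a == 0%N).
Proof. by case: a. Qed.

Lemma blk_typ (a : nat) : a != 0%N -> a = (3 * blk a + typ a)%N.
Proof. by case: a => // a _ /=; rewrite /blk /=; lia. Qed.

Lemma blk_typD (B t : nat) : (t < 3)%N ->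
  blk (3 * B + t.+1) = B /\ typ (3 * B + t.+1) = t.+1.
Proof. by rewrite addnS /blk /typ /= => t_lt3; lia. Qed.

(** * The wedge of gadgets at node 0 *)

Section Wedge.
Variables (R : realType) (m : nat).
Local Notation node := 'I_m.+1.
Implicit Types (a b : node) (B t : nat) (S : {set node}) (u : 'cV[R]_m.+1).

Definition near a b : bool :=
  [|| a == ord0, b == ord0 | blk a == blk b].

Definition wedge_arcs : {set node * node} :=
  [set e | near e.1 e.2 && ((typ e.1, typ e.2) \in garcs)].

Lemma wedge_loopless a : (a, a) \notin wedge_arcs.
Proof.
by rewrite in_set; apply/andP => -[_ /garcs_neq]; rewrite eqxx.
Qed.

Definition wedge : digraph m.+1 := Digraph wedge_loopless.

Definition wedge_cost : 'cV[R]_#|arcs wedge| :=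
  \col_i let: (a, b) := enum_val i : node * node in (gcost (typ a) (typ b))%:~R.

Definition wedge_poly : polyhedron R m.+1 :=
  dual_network_flow (ord0 : node) wedge_cost.

Lemma near_typ_inj a b : near a b -> typ a = typ b -> a = b.
Proof.
rewrite /near => Hab Ht; apply/val_inj => /=.
case/or3P: Hab => [/eqP a0|/eqP b0|/eqP Hb].
- by move: Ht; rewrite a0 /= => /esym/eqP; rewrite typ_eq0 => /eqP ->.
- by move: Ht; rewrite b0 /= => /eqP; rewrite typ_eq0 => /eqP ->.
have [a0|a0] := eqVneq (val a) 0%N.
  by move: Ht; rewrite a0 /= => /esym/eqP; rewrite typ_eq0 => /eqP ->.
rewrite (blk_typ _ a0) Hb Ht -blk_typ //.
by rewrite -typ_eq0 -Ht typ_eq0.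
Qed.

(** The gadget is complete as an undirected graph, and by [near_typ_inj] distinct nodes of a block
    have distinct types. *)
Lemma near_arcs a b : near a b -> a != b ->
  ((a, b) \in arcs wedge) || ((b, a) \in arcs wedge).
Proof.
move=> Hab neq_ab; rewrite !in_set /=.
have -> : near b a by rewrite /near orbCA (eq_sym (blk b)).
rewrite Hab /=; apply: garcs_total; rewrite ?typ_lt4 //.
by apply: contra neq_ab => /eqP/near_typ_inj ->.
Qed.

Lemma wedge_connected : connected wedge.
Proof.
have H0 a : connect (fun x y => ((x, y) \in arcs wedge) || ((y, x) \in arcs wedge))
      ord0 a.
  have [->|a0] := eqVneq a ord0; first exact: connect0.
  by apply/connect1/near_arcs; rewrite 1?eq_sym // /near eqxx.
have sym : connect_sym
    (fun x y : node => ((x, y) \in arcs wedge) || ((y, x) \in arcs wedge)).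
  by apply: sym_connect_sym => x y; rewrite orbC.
by move=> a b; apply: (connect_trans (y := ord0)); rewrite // sym.
Qed.

Lemma wedge_row u a b (ab : (a, b) \in arcs wedge) :
  (ineq_mx wedge_poly *m u) (enum_rank_in ab (a, b)) 0 = u a 0 - u b 0.
Proof.
have S1 c : \sum_(j : node) (j == c)%:R * u j 0 = u c 0.
  rewrite (bigD1 c) //= eqxx mul1r big1 ?addr0 // => j /negPf ->.
  by rewrite mul0r.
rewrite mxE -[in RHS]S1 -[in X in _ - X]S1 -sumrB.
by apply: eq_bigr => j _; rewrite mxE enum_rankK_in // mulrBl.
Qed.

Lemma arcs_rank (i : 'I_#|arcs wedge|) :
  exists a b (ab : (a, b) \in arcs wedge), i = enum_rank_in ab (a, b).
Proof.
have := enum_valP i; case E: (enum_val i) => [a b] ab.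
by exists a, b, ab; apply: enum_val_inj; rewrite enum_rankK_in.
Qed.

Lemma wedge_row0 u :
  (Defs.eq_mx wedge_poly *m u = eq_rhs wedge_poly) <-> u ord0 0 = 0.
Proof.
rewrite /= -rowE; split=> [/matrixP/(_ 0 0)|H]; first by rewrite !mxE.
by apply/matrixP=> i j; rewrite !mxE !ord1.
Qed.

Lemma in_wedge u : in_poly wedge_poly u <->
  u ord0 0 = 0 /\ forall a b, (a, b) \in arcs wedge ->
    u b 0 - u a 0 <= (gcost (typ a) (typ b))%:~R.
Proof.
rewrite in_dual_network_flow; split=> -[H1 H2].
  split=> // a b ab; have := H1 (enum_rank_in ab (a, b)).
  by rewrite mxE enum_rankK_in // addrC.
split=> // i; rewrite mxE; have := enum_valP i.
by case: (enum_val i) => a b ab; rewrite addrC; apply: H2.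
Qed.

Lemma supp_wedge u a b (ab : (a, b) \in arcs wedge) :
  (enum_rank_in ab (a, b) \in supp (ineq_mx wedge_poly *m u))
  = (u a 0 != u b 0).
Proof. by rewrite inE wedge_row subr_eq0. Qed.

(** * Circuits of the wedge *)

Definition indic S : 'cV[R]_m.+1 := \col_a (a \in S)%:R.

Definition in_block S B : Prop := forall a, a \in S -> a != ord0 /\ blk a = B.

Lemma nonzero_ker_wedge u :
  nonzero_ker wedge_poly u <-> u != 0 /\ u ord0 0 = 0.
Proof. by rewrite /nonzero_ker -wedge_row0. Qed.

(** Distinct near nodes are joined by an arc, whose row lies in the support exactly if the values at
    its ends differ. *)
Lemma supp_const u u' a b :
  supp (ineq_mx wedge_poly *m u) \subset supp (ineq_mx wedge_poly *m u') ->
  near a b -> u' a 0 = u' b 0 -> u a 0 = u b 0.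
Proof.
move=> sub Hab Hu; have [->//|neq_ab] := eqVneq a b.
have /orP[ab|ba] := near_arcs _ _ Hab neq_ab.
  apply/eqP; apply: contraTT isT => Hu'.
  have := subsetP sub (enum_rank_in ab (a, b)).
  by rewrite !supp_wedge Hu eqxx Hu' => /(_ isT).
apply/eqP; apply: contraTT isT; rewrite eq_sym => Hu'.
have := subsetP sub (enum_rank_in ba (b, a)).
by rewrite !supp_wedge Hu eqxx Hu' => /(_ isT).
Qed.

Lemma supp_scale (e : R) u : e != 0 ->
  supp (ineq_mx wedge_poly *m (e *: u)) = supp (ineq_mx wedge_poly *m u).
Proof.
by move=> e0; apply/setP => i; rewrite !inE -scalemxAr mxE mulf_eq0 negb_or e0.
Qed.

(** A competitor with smaller support would be constant on [S] and, by comparison with node 0,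
    vanish outside. It is then a nonzero multiple of the indicator, with the same support. *)
Lemma circuit_indic S B (e : int) : in_block S B -> S != set0 ->
  e \in [:: 1; -1] -> circuit wedge_poly (e%:~R *: indic S).
Proof.
move=> SB /set0Pn[a aS] He.
have e0 : (e%:~R : R) != 0.
  by rewrite intr_eq0; move: He; rewrite !inE => /orP[]/eqP ->.
have S0 : ord0 \notin S by apply/negP => /SB[]; rewrite eqxx.
split.
- apply/nonzero_ker_wedge; split; last by rewrite !mxE (negPf S0) mulr0.
  apply/eqP => /matrixP/(_ a 0) /eqP; rewrite !mxE aS mulr1.
  by rewrite (negPf e0).
- exists (\col_a (e * (a \in S)%:R)); split.
    by apply/matrixP => i j; rewrite !mxE intrM; case: (_ \in S).
  apply/eqP; rewrite -dvdn1.
  have : absz ((\col_a (e * (a \in S)%:R) : 'cV[int]_m.+1) a 0) = 1%N.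
    by rewrite mxE aS mulr1; move: He; rewrite !inE => /orP[]/eqP ->.
  move=> abs1; rewrite -[X in (_ %| X)%N]abs1.
  exact: (dvdn_biggcdP _ _ _ (dvdnn _)).
move=> x /nonzero_ker_wedge[x0 xo]; rewrite supp_scale //.
apply/negP => /andP[sub nsub].
have xout b : b \notin S -> x b 0 = 0.
  move=> bS; rewrite -xo; apply: (supp_const _ _ _ _ sub).
    by rewrite /near eqxx orbT.
  by rewrite !mxE (negPf bS) (negPf S0).
have xin b : b \in S -> x b 0 = x a 0.
  move=> bS; apply: (supp_const _ _ _ _ sub); last by rewrite !mxE bS aS.
  by rewrite /near (SB _ aS).2 (SB _ bS).2 eqxx !orbT.
have Ex : x = x a 0 *: indic S.
  apply/matrixP => b j; rewrite !ord1 !mxE.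
  case: (boolP (b \in S)) => bS.
    by rewrite xin // mulr1.
  by rewrite xout // mulr0.
have xa0 : x a 0 != 0.
  by apply: contraNneq x0 => xa0; rewrite Ex xa0 scale0r.
by case/negP: nsub; rewrite Ex supp_scale.
Qed.

(** The indicator of a nonzero level set of [g] inside one block has its support within that of [g].
    Minimality makes the supports equal, so [g] is a multiple of this indicator, and coprimality
    makes the factor 1 or -1. *)
Lemma circuit_wedge g : circuit wedge_poly g ->
  exists B S (e : int), [/\ in_block S B, e \in [:: 1; -1] & g = e%:~R *: indic S].
Proof.
case=> /nonzero_ker_wedge[g0 go] [z [gz gcdz]] gmin.
have [a ga0] : exists a, g a 0 != 0.
  apply: contrapT => no; case/eqP: g0; apply/matrixP => a j.
  by rewrite ord1 mxE; apply/eqP; apply: contraPT no => ga; case; exists a.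
pose S := [set b : node | [&& b != ord0, blk b == blk a & g b 0 == g a 0]].
have a_neq0 : a != ord0 by apply: contraNneq ga0 => ->; rewrite go.
have aS : a \in S by rewrite inE a_neq0 !eqxx.
have S0 : ord0 \notin S by rewrite inE eqxx.
have SB : in_block S (blk a) by move=> b; rewrite inE => /and3P[-> /eqP].
have kerS : nonzero_ker wedge_poly (indic S).
  apply/nonzero_ker_wedge; split; last by rewrite mxE (negPf S0).
  by apply/eqP => /matrixP/(_ a 0)/eqP; rewrite !mxE aS oner_eq0.
(* Either [c] lies in the same block, off the level set, or it is node 0, where [g] vanishes. *)
have crossing b c : b \in S -> c \notin S -> near b c -> g b 0 != g c 0.
  move=> bS cS bc; apply: contraNneq cS => gbc.
  have gb : g b 0 = g a 0 by move: bS; rewrite inE => /and3P[_ _ /eqP].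
  have [b_neq0 bB] := SB _ bS.
  have c_neq0 : c != ord0.
    by apply: contraNneq ga0 => c0; rewrite -gb gbc c0 go.
  move: bc; rewrite /near (negPf b_neq0) (negPf c_neq0) /= => /eqP bc.
  by rewrite inE c_neq0 -bc bB -gbc gb !eqxx.
have sub : supp (ineq_mx wedge_poly *m indic S) \subset
           supp (ineq_mx wedge_poly *m g).
  apply/subsetP => i; have [b [c [bc ->]]] := arcs_rank i.
  rewrite !supp_wedge !mxE.
  have nbc : near b c by move: bc; rewrite in_set => /andP[].
  have ncb : near c b by rewrite /near orbCA (eq_sym (blk c)).
  case: (boolP (b \in S)) => bS; case: (boolP (c \in S)) => cS;
    rewrite ?eqxx // => _; first exact: crossing.
  by rewrite eq_sym; apply: crossing.
have bus : supp (ineq_mx wedge_poly *m g) \subset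
           supp (ineq_mx wedge_poly *m indic S).
  by have := gmin _ kerS; rewrite properE sub /= negbK.
have gout b : b \notin S -> g b 0 = 0.
  move=> bS; rewrite -go; apply: (supp_const _ _ _ _ bus).
    by rewrite /near eqxx orbT.
  by rewrite !mxE (negPf bS) (negPf S0).
have Eg b : g b 0 = g a 0 * (b \in S)%:R.
  case: (boolP (b \in S)) => bS; last by rewrite gout ?mulr0.
  by move: bS; rewrite inE mulr1 => /and3P[_ _ /eqP].
have Ez b : z b 0 = z a 0 * (b \in S)%:R.
  apply/eqP; rewrite -(eqr_int R) intrM.
  by have := Eg b; rewrite gz !mxE => ->; case: (b \in S).
exists (blk a), S, (z a 0%R); split=> //.
  have : (absz (z a 0%R) %| 1)%N.
    rewrite -[X in (_ %| X)%N]gcdz; apply/dvdn_biggcdP => b _; rewrite (Ez b) abszM.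
    exact: dvdn_mulr.
  by rewrite dvdn1 !inE; lia.
by apply/matrixP => b j; rewrite ord1 Eg gz !mxE.
Qed.

(** * Lower bound: walks seen in the single blocks *)

Definition gnode B t : node := inord (if t == 0 then 0 else 3 * B + t)%N.

Definition full B : bool := (3 * B + 3 <= m)%N.

Lemma gnode0 B : gnode B 0 = ord0.
Proof. by apply/val_inj; rewrite /= inordK. Qed.

(** Fullness keeps [inord] from its default value, node 0. *)
Lemma gnode_val B t : full B -> (0 < t < 4)%N -> val (gnode B t) = (3 * B + t)%N.
Proof.
by rewrite /full /gnode; case: t => // t fB t_in; rewrite /= inordK //; lia.
Qed.

Lemma gnode_typ B t : full B -> (t < 4)%N -> typ (gnode B t) = t.
Proof.
case: t => [|t] fB t_lt4; first by rewrite gnode0.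
by rewrite gnode_val //; case: (blk_typD B t).
Qed.

Lemma gnode_blk B t : full B -> (0 < t < 4)%N -> blk (gnode B t) = B.
Proof.
move=> fB t_in; rewrite gnode_val //; case: t t_in => // t t_in.
by case: (blk_typD B t).
Qed.

Lemma typ_gnode B a : (a == ord0) || (blk a == B) -> gnode B (typ a) = a.
Proof.
move=> aB; apply/val_inj; rewrite /gnode typ_eq0.
have [a0|a0] := eqVneq (val a) 0%N; first by rewrite /= inordK.
have /eqP <- : blk a == B by move: aB; rewrite -val_eqE /= (negPf a0).
by rewrite -blk_typ // /= inordK.
Qed.

Lemma gnode_arc B t t' : full B -> (t, t') \in garcs ->
  (gnode B t, gnode B t') \in arcs wedge.
Proof.
move=> fB tt'.
have /andP[t_lt4 t'_lt4] := garcs_lt4 _ _ tt'.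
rewrite in_set /= !gnode_typ // tt' andbT /near.
case: t t_lt4 {tt'} => [|t] t_lt4; first by rewrite gnode0 eqxx.
case: t' t'_lt4 => [|t'] t'_lt4; first by rewrite gnode0 eqxx orbT.
by rewrite !gnode_blk // eqxx !orbT.
Qed.

Definition has_state u B (s : seq int) : Prop :=
  forall t, (t < 4)%N -> u (gnode B t) 0 = (s`_t)%:~R.

Lemma has_state_feas u B s : full B -> in_poly wedge_poly u -> size s = 4%N ->
  has_state u B s -> gfeas s.
Proof.
move=> fB /in_wedge[u0 u_in] size_s us; apply/and3P; split.
- exact/eqP.
- by rewrite -(eqr_int R) -us // gnode0 u0.
- apply/allP => -[t t'] tt' /=; have ab := gnode_arc _ _ _ fB tt'.
  have /andP[t_lt4 t'_lt4] := garcs_lt4 _ _ tt'.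
  by have := u_in _ _ ab; rewrite !us // !gnode_typ // -intrB ler_int.
Qed.

(** Otherwise every arc that grows along [g] has positive slack at [u'], and [uniform_room] allows a
    step beyond [alpha]. *)
Lemma blocking_arc u u' g (alpha : R) : in_poly wedge_poly u' ->
  u' - u = alpha *: g -> g ord0 0 = 0 ->
  (forall beta, alpha < beta -> ~ in_poly wedge_poly (u + beta *: g)) ->
  exists a b, [/\ (a, b) \in arcs wedge, g b 0 - g a 0 > 0 &
    u' b 0 - u' a 0 = (gcost (typ a) (typ b))%:~R].
Proof.
move=> /in_wedge[u'0 u'_in] Hu g0 gmax; apply: contrapT => no.
(* Pairs that are not arcs get slack 0 and growth 0, so that all pairs can serve as indices. *)
pose s (e : node * node) : R := if e \in arcs wedge then
  (gcost (typ e.1) (typ e.2))%:~R - (u' e.2 0 - u' e.1 0) else 0.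
pose h (e : node * node) : R := if e \in arcs wedge then
  g e.2 0 - g e.1 0 else 0.
have [[a b]|[a b]|eps eps0 Heps] := uniform_room _ _ s h.
- by rewrite /s; case: ifP => // ab; rewrite subr_ge0; apply: u'_in.
- rewrite /s /h; case: ifP => // ab /eqP; rewrite subr_eq0 => /eqP Hab /=.
  by rewrite leNgt; apply/negP => gab; apply: no; exists a, b.
apply: (gmax (alpha + eps)); first by rewrite ltrDl.
have -> : u + (alpha + eps) *: g = u' + eps *: g.
  by rewrite scalerDl -Hu addrA subrKC.
apply/in_wedge; split=> [|a b ab]; first by rewrite !mxE u'0 g0 mulr0 addr0.
by have := Heps (a, b); rewrite /s /h ab /= !mxE; lra.
Qed.

(** The direction is plus or minus the indicator of a set in [B0], so other blocks keep their
    states. In a full [B0] the blocking arc grows by exactly 1, so the step length is its slack, an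
    integer. *)
Lemma step_gadget u u' : in_poly wedge_poly u -> in_poly wedge_poly u' ->
  circuit_step wedge_poly u u' ->
  exists B0, forall B s, full B -> has_state u B s ->
    if B == B0 then exists2 s', s' \in gsucc s & has_state u' B s'
    else has_state u' B s.
Proof.
move=> u_in u'_in [g [alpha [/circuit_wedge[B0 [S [e [SB e1 gS]]]] alpha0 Hu gmax]]].
have S0 : ord0 \notin S by apply/negP => /SB[]; rewrite eqxx.
have Eg b : g b 0 = (e * (b \in S)%:R)%:~R.
  by rewrite gS !mxE intrM; case: (b \in S).
have Eu b : u' b 0 = u b 0 + alpha * g b 0.
  have := congr1 (fun M : 'cV[R]_m.+1 => M b 0) Hu; rewrite !mxE; lra.
exists B0 => B s fB us; case: eqP => [EB|/eqP nB]; last first.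
  move=> t t_lt4; rewrite Eu us // Eg.
  suff -> : gnode B t \in S = false by rewrite mulr0 mulr0 addr0.
  apply/negP => /[dup] tS /SB[t_neq0 tB]; case/eqP: nB; rewrite -tB.
  rewrite gnode_blk // t_lt4 andbT lt0n.
  by apply: contraNneq t_neq0 => ->; rewrite gnode0.
subst B0.
pose d := 0 :: [seq e * x | x <- [seq (gnode B t \in S)%:R | t <- iota 1 3]].
have d_in : d \in gdirs.
  apply/allpairsP; exists (e, [seq (gnode B t \in S)%:R | t <- iota 1 3]); split=> //.
  by rewrite /=; do 3!case: (_ \in S).
have Ed t : (t < 4)%N -> d`_t = e * (gnode B t \in S)%:R.
  by case: t => [|[|[|[|t]]]] //; rewrite gnode0 (negPf S0) mulr0.
have g0 : g ord0 0 = 0 by rewrite Eg (negPf S0) mulr0.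
have [a [b [ab gab Hab]]] := blocking_arc _ _ _ _ u'_in Hu g0 gmax.
have /andP[nab tt'] : near a b && ((typ a, typ b) \in garcs).
  by move: ab; rewrite in_set.
(* Only arcs meeting [S] grow, so each end of the blocking arc is in block [B] or is node 0. *)
have abS : (a \in S) || (b \in S).
  apply: contraTT gab; rewrite negb_or !Eg => /andP[/negPf-> /negPf->].
  by rewrite subrr ltxx.
have /andP[aB bB] : ((a == ord0) || (blk a == B)) && ((b == ord0) || (blk b == B)).
  move: nab; rewrite /near; case/orP: abS => /SB[/negPf-> ->].
    by rewrite eqxx (eq_sym B).
  by rewrite eqxx orbT andbT.
have [Ea Eb] := (typ_gnode _ _ aB, typ_gnode _ _ bB).
have ta := typ_lt4 a; have tb := typ_lt4 b.
have dab : d`_(typ b) - d`_(typ a) = 1.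
  move: gab; rewrite !Eg !Ed // Ea Eb -intrB ltr0z.
  by move: e1; rewrite !inE => /orP[]/eqP->; case: (a \in S); case: (b \in S).
pose al := gcost (typ a) (typ b) - (s`_(typ b) - s`_(typ a)).
have Eal : alpha = al%:~R.
  move: Hab; rewrite !Eu !Eg -Ea -Eb -!Ed // !us // !Ea !Eb /al !intrB.
  have : (d`_(typ b))%:~R - (d`_(typ a))%:~R = 1 :> R by rewrite -intrB dab.
  by nra.
have us' : has_state u' B (gmove s d al).
  move=> t t_lt4; rewrite nth_mkseq // Eu us // Eg -Ed // Eal.
  by rewrite [RHS]intrD intrM.
exists (gmove s d al) => //; rewrite mem_filter.
rewrite (has_state_feas u' B) ?size_mkseq // andTb.
apply/allpairsPdep; exists d, (typ a, typ b); split=> //.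
by rewrite mem_filter dab eqxx.
Qed.

(** Here [f B] counts the steps that move block [B]. The sum may fall short of [k], since a step can
    also move a block beyond the first [j]. *)
Lemma walk_gadgets j w k p : (3 * j <= m)%N -> in_poly wedge_poly w ->
  (forall B, (B < j)%N -> has_state (p 0%N) B gstart) ->
  circuit_walk wedge_poly (p 0%N) w k p ->
  exists2 f : nat -> nat, (\sum_(B < j) f B <= k)%N &
    forall B, (B < j)%N -> exists2 s, s \in greach (f B) & has_state w B s.
Proof.
move=> j_le w_in p0 [_ pk Hp]; rewrite -pk.
(* A walk asserts feasibility only before its last point, which is [w]. *)
have p_in i : (i <= k)%N -> in_poly wedge_poly (p i).
  by rewrite leq_eqVlt => /predU1P[->|/Hp[]//]; rewrite pk.
suff H i : (i <= k)%N -> exists2 f : nat -> nat, (\sum_(B < j) f B <= i)%N &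
    forall B, (B < j)%N -> exists2 s, s \in greach (f B) & has_state (p i) B s.
  exact: H.
elim: i => [_|i IHi lt_ik].
  exists (fun=> 0%N); first by rewrite big1.
  by move=> B Bj; exists gstart; [rewrite mem_head | apply: p0].
have [f sum_f Hf] := IHi (ltnW lt_ik).
have [_ step_i] := Hp i lt_ik.
have [B0 HB0] := step_gadget _ _ (p_in i (ltnW lt_ik)) (p_in i.+1 lt_ik) step_i.
exists (fun B => f B + (B == B0))%N.
  rewrite big_split /= -addn1 leq_add //.
  case: (ltnP B0 j) => B0j.
    rewrite (bigD1 (Ordinal B0j)) //= eqxx big1 // => B.
    by rewrite -val_eqE /= => /negPf->.
  by rewrite big1 // => B _; case: eqP => // EB; have := ltn_ord B; lia.
move=> B Bj; have [s s_in sB] := Hf B Bj.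
have fB : full B by rewrite /full; lia.
have := HB0 B s fB sB; case: eqP => _; last by rewrite addn0; exists s.
case=> s' s'_in s'B; exists s' => //; rewrite addn1 /greach iterS mem_undup.
by apply/flattenP; exists (gsucc s) => //; apply: map_f.
Qed.

(** By [greach_far] each of the [j] blocks accounts for at least 4 steps, and no step counts for two
    blocks. *)
Lemma walk_length j v w k p : (3 * j <= m)%N -> in_poly wedge_poly w ->
  (forall B, (B < j)%N -> has_state v B gstart) ->
  (forall B, (B < j)%N -> has_state w B gend) ->
  circuit_walk wedge_poly v w k p -> (4 * j <= k)%N.
Proof.
move=> j_le w_in vB wB Hp; have p0 : p 0%N = v by case: Hp.
rewrite -p0 in vB Hp.
have [f sum_f Hf] := walk_gadgets _ _ _ _ j_le w_in vB Hp.
apply: leq_trans sum_f; rewrite mulnC -[j in (j * _)%N]card_ord -sum_nat_const.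
apply: leq_sum => B _; have [s s_in sB] := Hf B (ltn_ord B).
apply: greach_far; apply/hasP; exists s => //; apply/allP => t.
rewrite mem_iota /= => t_lt4.
by rewrite -(eqr_int R) -sB // (wB B).
Qed.

(** * Points, vertices and a walk assembled from gadget states *)

Definition wpoint (z : nat -> seq int) : 'cV[R]_m.+1 :=
  \col_a ((z (blk a))`_(typ a))%:~R.

Lemma wpointE z B a : (forall B, gfeas (z B)) -> (a == ord0) || (blk a == B) ->
  wpoint z a 0 = ((z B)`_(typ a))%:~R.
Proof.
move=> z_in /orP[/eqP->|/eqP<-]; rewrite mxE //=.
by case/and3P: (z_in 0%N) => _ /eqP -> _; case/and3P: (z_in B) => _ /eqP ->.
Qed.

Lemma gnode_in B t : full B -> (t < 4)%N ->
  (gnode B t == ord0) || (blk (gnode B t) == B).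
Proof.
by case: t => [|t] fB t_lt4; rewrite ?gnode0 ?eqxx // gnode_blk // eqxx orbT.
Qed.

Lemma wpoint_state z B : (forall B, gfeas (z B)) -> full B ->
  has_state (wpoint z) B (z B).
Proof.
by move=> z_in fB t t_lt4; rewrite (wpointE z B) ?gnode_typ // gnode_in.
Qed.

Lemma near_block a b : near a b -> exists B,
  ((a == ord0) || (blk a == B)) && ((b == ord0) || (blk b == B)).
Proof.
rewrite /near => /or3P[->|->|/eqP->]; last by exists (blk b); rewrite eqxx !orbT.
  by exists (blk b); rewrite eqxx orbT.
by exists (blk a); rewrite eqxx orbT.
Qed.

Lemma in_wpoint z : (forall B, gfeas (z B)) -> in_poly wedge_poly (wpoint z).
Proof.
move=> z_in; apply/in_wedge; split=> [|a b].
  by rewrite mxE /=; case/and3P: (z_in 0%N) => _ /eqP ->.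
rewrite in_set => /andP[/near_block[B /andP[aB bB]] ab].
rewrite !(wpointE z B) // -intrB ler_int.
by case/and3P: (z_in B) => _ _ /allP/(_ _ ab).
Qed.

(** An arc tight at a proper convex combination is tight at both [x] and [y]. Following tight arcs
    to smaller indices, down to node 0, determines every coordinate. *)
Lemma vertex_wpoint z : (forall B, gfeas (z B)) -> (forall B, gtree (z B)) ->
  vertex wedge_poly (wpoint z).
Proof.
move=> z_in z_tree; have v_in := in_wpoint _ z_in; split=> // x y l x_in y_in l01 Hv.
suff H : forall a, x a 0 = wpoint z a 0 /\ y a 0 = wpoint z a 0.
  by split; apply/matrixP => a j; rewrite ord1; case: (H a).
case/in_wedge: x_in => x0 x_in; case/in_wedge: y_in => y0 y_in.
case/in_wedge: v_in => v0 v_in.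
have Ev a : wpoint z a 0 = l * x a 0 + (1 - l) * y a 0 by rewrite {1}Hv !mxE.
case/andP: l01 => l0 l1.
have tight a b : (a, b) \in arcs wedge ->
    wpoint z b 0 - wpoint z a 0 = (gcost (typ a) (typ b))%:~R ->
    x b 0 - x a 0 = wpoint z b 0 - wpoint z a 0 /\
    y b 0 - y a 0 = wpoint z b 0 - wpoint z a 0.
  move=> ab Hab; have := x_in _ _ ab; have := y_in _ _ ab.
  by rewrite -Hab !Ev; nra.
move=> a; have [k] := ubnP (val a); elim: k a => // k IHk a a_lt.
have [->|a0] := eqVneq a ord0; first by rewrite x0 y0 v0.
have ta : typ a \in iota 1 3.
  by rewrite mem_iota typ_lt4 andbT lt0n typ_eq0.
have /hasP[t'] := allP (z_tree (blk a)) _ ta; rewrite mem_iota add0n /= => t'_lt tt'.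
pose b := gnode (blk a) t'.
have Ea : nat_of_ord a = (3 * blk a + typ a)%N by apply: blk_typ.
have t_lt4 := typ_lt4 a; have am := ltn_ord a.
(* As [t'] is below [typ a], the index of [b] is below that of [a], hence in range even in a
   truncated block. *)
have bv : (t' = 0 /\ b = ord0 \/ 0 < t' /\ nat_of_ord b = 3 * blk a + t')%N.
  case: (posnP t') => [Et'|t'_gt0]; [left|right]; split=> //.
    by rewrite /b Et' gnode0.
  by rewrite /b /gnode gtn_eqF //= inordK //; lia.
have [b_in tb] : ((b == ord0) || (blk b == blk a)) /\ typ b = t'.
  case: bv => -[Ht Hb]; first by rewrite Hb Ht eqxx.
  have [|] := blk_typD (blk a) t'.-1; first by lia.
  by rewrite prednK // -Hb => -> ->; rewrite eqxx orbT.
have b_lt : (nat_of_ord b < k)%N.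
  apply: leq_trans (a_lt : (nat_of_ord a <= k)%N); rewrite Ea.
  by case: bv => -[Ht Hb]; rewrite Hb /=; lia.
have [xb yb] := IHk b b_lt.
have nab : near a b.
  by rewrite /near; case/orP: b_in => [->|/eqP->]; rewrite ?eqxx !orbT.
have nba : near b a by rewrite /near orbCA (eq_sym (blk b)).
have aa : (a == ord0) || (blk a == blk a) by rewrite eqxx orbT.
case/orP: tt' => /andP[tt' /eqP Htt'].
  have ab : (a, b) \in arcs wedge by rewrite in_set /= nab tb.
  have [||Hx Hy] := tight a b => //; last by split; lra.
  by rewrite !(wpointE z (blk a)) // tb -intrB Htt'.
have ba : (b, a) \in arcs wedge by rewrite in_set /= nba tb.
have [||Hx Hy] := tight b a => //; last by split; lra.
by rewrite !(wpointE z (blk a)) // tb -intrB Htt'.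
Qed.

(** A converse of [step_gadget]. Since the state changes, the slack of the chosen arc is positive;
    this arc becomes tight and grows along the direction, so going further violates it. *)
Lemma step_wpoint z z' B : full B ->
  (forall B, gfeas (z B)) -> (forall B, gfeas (z' B)) ->
  (forall B', B' != B -> z' B' = z B') -> z' B \in gsucc (z B) -> z' B != z B ->
  circuit_step wedge_poly (wpoint z) (wpoint z').
Proof.
move=> fB z_in z'_in Ez; rewrite mem_filter => /andP[_ /allpairsPdep].
case=> d [[t t'] [d_in]]; rewrite mem_filter => /andP[/= /eqP dtt' tt'].
set al := (_ - _) => Ez' nzz'.
have [size_z z0 z_arcs] := and3P (z_in B).
have al_gt0 : 0 < al.
  rewrite lt0r subr_ge0 (allP z_arcs _ tt') andbT.
  apply: contraNneq nzz' => al0; rewrite Ez' al0.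
  apply/eqP/(@eq_from_nth _ 0); rewrite size_mkseq ?(eqP size_z) // => i i_lt4.
  by rewrite nth_mkseq // mul0r addr0.
have /andP[t_lt4 t'_lt4] := garcs_lt4 _ _ tt'.
case/allpairsP: d_in => -[e b] /= [e1 b_in Ed].
have b01 i : (b`_i == 0) || (b`_i == 1).
  have : all (fun x => (x == 0) || (x == 1)) b.
    by apply: (allP (_ : all (all (fun x => (x == 0) || (x == 1))) cube) b).
  case: (ltnP i (size b)) => [/(mem_nth 0) bi /allP/(_ _ bi) //|le_i _].
  by rewrite nth_default.
have size_b : size b = 3%N.
  by have /allP/(_ _ b_in)/eqP : all (fun s => size s == 3%N) cube by [].
have Edt i : (i < 4)%N -> d`_i = e * (0 :: b)`_i.
  rewrite Ed; case: i => [|i] i_lt4 /=; first by rewrite mulr0.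
  by rewrite (nth_map 0) ?size_b.
pose S := [set a : node | [&& a != ord0, blk a == B & (0 :: b)`_(typ a) == 1]].
have SB : in_block S B by move=> a; rewrite inE => /and3P[-> /eqP].
have gS a : (a == ord0) || (blk a == B) ->
    (e%:~R *: indic S) a 0 = (d`_(typ a))%:~R :> R.
  move=> aB; rewrite !mxE inE Edt ?typ_lt4 // intrM; congr (_ * _).
  have [a0|a0] := eqVneq a ord0; first by rewrite a0.
  move: aB; rewrite (negPf a0) /= => ->.
  have : (typ a != 0)%N by rewrite typ_eq0.
  by case: (typ a) => //= i _; case/orP: (b01 i) => /eqP ->.
have gnS i : (i < 4)%N -> (e%:~R *: indic S) (gnode B i) 0 = (d`_i)%:~R :> R.
  by move=> i_lt4; rewrite gS ?gnode_typ // gnode_in.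
exists (e%:~R *: indic S), al%:~R; split.
- apply: circuit_indic SB _ e1; apply/eqP => S0.
  have := gnS _ t_lt4; have := gnS _ t'_lt4; rewrite S0 !mxE !inE mulr0.
  move=> d't dt; have : (d`_t' - d`_t)%:~R = 0 :> R by rewrite intrB -d't -dt subrr.
  by rewrite dtt' => /eqP; rewrite oner_eq0.
- by rewrite ltr0z.
- apply/matrixP => a j; rewrite ord1 [LHS]mxE [X in _ + X]mxE [RHS]mxE.
  have [aB|] := boolP ((a == ord0) || (blk a == B)).
    rewrite gS // !(wpointE _ B) // Ez' nth_mkseq ?typ_lt4 //.
    by rewrite intrD intrM; lra.
  rewrite negb_or => /andP[a0 aB].
  by rewrite !mxE inE (negPf aB) andbF mulr0 mulr0 Ez // subrr.
move=> beta al_beta /in_wedge[_ /(_ _ _ (gnode_arc _ _ _ fB tt'))].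
rewrite [X in X - _]mxE [X in _ - X]mxE [X in _ + X - _]mxE [X in _ - (_ + X)]mxE.
rewrite !gnS // !wpoint_state // !gnode_typ //.
have d1 : (d`_t')%:~R - (d`_t)%:~R = 1 :> R by rewrite -intrB dtt'.
by move: al_beta; rewrite /al !intrB; nra.
Qed.

(* The blocks are processed in order, 4 steps each: truncated subtraction and minn
   keep a block at gstart before its turn and at gend afterwards. *)
Definition wstate j i B : seq int :=
  if (B < j)%N then nth gend gpath (minn 4 (i - 4 * B)) else gend.

Lemma wstate_feas j i B : gfeas (wstate j i B).
Proof.
rewrite /wstate; case: ifP => // _; apply: (allP gpath_feas).
by apply: mem_nth; rewrite ltnS geq_minl.
Qed.

Lemma wpoint_walk j : (3 * j <= m)%N ->
  circuit_walk wedge_poly (wpoint (wstate j 0)) (wpoint (fun=> gend)) (4 * j)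
    (fun i => wpoint (wstate j i)).
Proof.
move=> j_le; split=> // [|i lt_i].
  congr wpoint; apply/funext => B; rewrite /wstate; case: ifP => // Bj.
  by rewrite (_ : minn _ _ = 4%N) //; lia.
split; first exact/in_wpoint/wstate_feas.
(* At time [4 * B + r] only block [B] moves, from stage [r] to [r.+1]; the other blocks below [j]
   are clamped at stage 0 or 4. *)
have [r [B [r_lt4 Ei]]] : exists r B, (r < 4)%N /\ i = (4 * B + r)%N.
  by exists (i %% 4)%N, (i %/ 4)%N; lia.
have Bj : (B < j)%N by lia.
have Er : minn 4 (i - 4 * B) = r by lia.
have Er' : minn 4 (i.+1 - 4 * B) = r.+1 by lia.
have [step_r neq_r] := gpath_step r r_lt4.
apply: (@step_wpoint _ _ B); rewrite ?/full; first by lia.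
- exact: wstate_feas.
- exact: wstate_feas.
- move=> B' nB; rewrite /wstate; case: ifP => // _; congr nth.
  by move/eqP: nB; lia.
- by rewrite /wstate Bj Er Er'.
- by rewrite /wstate Bj Er Er'.
Qed.

Lemma wedge_diameter :
  exists2 d, circuit_diameter wedge_poly d & (4 * (m %/ 3) <= d)%N.
Proof.
have j_le : (3 * (m %/ 3) <= m)%N by lia.
set j := (m %/ 3)%N in j_le *.
have end_feas (B : nat) : gfeas gend by [].
apply: (circuit_diameter_ge _ _ _ _ _ _ _ _ _ _ (wpoint_walk _ j_le)).
- apply: vertex_wpoint => B; first exact: wstate_feas.
  by rewrite /wstate; case: ifP.
- by apply: vertex_wpoint.
move=> l q; apply: walk_length => //; first exact: in_wpoint.
  move=> B Bj; have := wpoint_state _ B (wstate_feas j 0).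
  by rewrite /wstate Bj /=; apply; rewrite /full; lia.
by move=> B Bj; apply: (wpoint_state (fun=> gend)) => //; rewrite /full; lia.
Qed.

End Wedge.

Theorem lemma1 (R : realType) (n : nat) (hn : (4 <= n)%N) :
  exists (G : digraph n) (o : 'I_n) (c : 'cV[R]_#|arcs G|) (d : nat),
    [/\ connected G,
        circuit_diameter (dual_network_flow o c) d &
        4 / 3 * n%:R - 4 <= d%:R :> R].
Proof.
case: n hn => // m _; have [d diam_d le_d] := wedge_diameter R m.
exists (wedge m), ord0, (wedge_cost R m), d; split=> //.
  exact: wedge_connected.
(* Since [3 * (m %/ 3)] is at least [m - 2], [3 * d] is at least [4 * m - 8]. *)
have : (4 * m.+1 <= 3 * d + 12)%N by lia.
by rewrite -(ler_nat R) natrD !natrM; lra.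
Qed.
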